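(* Let $G$ be a graph with $n$ vertices and $S(G)=N$. Then $$|E(G)|\le\begin{cases}\left\lfloor\frac{Nn}{2}-\frac{N^2}{8}-\frac{N}{8}+\frac{\lfloor\frac{N+1}{2}\rfloor}{4}\right\rfloor & \text{if } N\le n-1,\\[2mm] \left\lfloor\frac{Nn}{4}+\frac{n^2}{8}-\frac{N}{4}+\frac{n}{8}+\frac{\lfloor\frac{N+1}{2}\rfloor}{4}-\frac14\right\rfloor & \text{if } N\ge n.\end{cases}$$
   Context: For a finite simple graph $G=(V,E)$ and an injective map $f:V\to\mathbb Z$, let $\sigma(G,f)=\{f(v)+f(w): vw\in E\}$. The sum index of $G$ is $S(G)=\min_{f}|\sigma(G,f)|$ over all injective $f:V\to\mathbb Z$. *)

(* Defs.v *)
From HB Require Import structures.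
From mathcomp Require Import all_boot all_order all_algebra.
From mathcomp Require Import archimedean finmap boolp.

Set Implicit Arguments.
Unset Strict Implicit.
Unset Printing Implicit Defensive.

Import Order.TTheory GRing.Theory Num.Theory.

Local Open Scope ring_scope.

Record sgraph := SGraph {
  svertex :> finType;
  sadj : rel svertex;
  sadj_sym : symmetric sadj;
  sadj_irr : irreflexive sadj
}.

Definition edge_set (G : sgraph) : {set {set G}} :=
  [set [set p.1; p.2] | p in [set p : G * G | sadj p.1 p.2]].

Definition edge_sums (G : sgraph) (f : G -> int) : {fset int} :=
  [fset (f p.1 + f p.2)%R | p in [set p : G * G | sadj p.1 p.2]]%fset.

Definition sum_count (G : sgraph) (k : nat) : Prop :=
  exists2 f : G -> int, injective f & #|` edge_sums f| = k.

Lemma sum_count_ex (G : sgraph) : exists k, `[< sum_count G k >].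
Proof.
pose f (v : G) : int := (enum_rank v : nat)%:Z.
exists #|` edge_sums f|; apply/asboolP; exists f => // v w [fvw].
exact/enum_rank_inj/val_inj.
Qed.

Definition sum_index (G : sgraph) : nat := ex_minn (sum_count_ex G).

Lemma sum_indexP (G : sgraph) (k : nat) :
  sum_index G = k <->
  sum_count G k /\
  (forall f : G -> int, injective f -> (k <= #|` edge_sums f|)%N).
Proof.
rewrite /sum_index; case: ex_minnP => m /asboolP Gm m_min; split.
  by move=> <-; split=> // f f_inj; apply/m_min/asboolP; exists f.
case=> Gk k_min; apply/eqP; rewrite eqn_leq m_min; last exact/asboolP.
by case: Gm => f f_inj <-; apply: k_min.
Qed.

(* Main.v *)
Require Import Defs.
From HB Require Import structures.
From mathcomp Require Import all_boot all_order all_algebra.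
From mathcomp Require Import archimedean.
From mathcomp Require Import finmap zify lra.

(**
  Fix an injective labelling [f] with [N] edge sums.  If [a] and [b] are the
  vertices of smallest and largest label, the sums along the edges meeting
  [{a, b}] are pairwise distinct: the sums [f a + f v] increase with [v] up
  to [f a + f b], and the sums [f u + f b] increase from there on.  Hence at
  most [min (N, 2n - 3)] edges meet [{a, b}], and deleting both vertices and
  iterating bounds the number of edges by the sum of the numbers
  [min (N, 2 (n - 2k) - 3)].  The quadratic estimates for this sum follow by
  induction on [n] in steps of two.
*)

Import Order.TTheory GRing.Theory Num.Theory.

Local Open Scope ring_scope.

Fixpoint peel_bound (N n : nat) : nat :=
  if n is n'.+2 then (peel_bound N n' + minn N (2 * n').+1)%N else 0%N.

Lemma nat_ind2 (P : nat -> Prop) :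
  P 0%N -> P 1%N -> (forall n, P n -> P n.+2) -> forall n, P n.
Proof.
move=> P0 P1 PS n; suff [] : P n /\ P n.+1 by [].
by elim: n => [//|n [Pn PSn]]; split=> //; apply: PS.
Qed.

(** Each step adds at most [2 * n' + 1], the difference of the binomial coefficients of [n' + 2] and
    of [n'] over 2. *)
Lemma peel_bound_bin2 (N n : nat) : (2 * peel_bound N n <= n * (n - 1))%N.
Proof. by elim/nat_ind2: n => [||n IHn] //=; nia. Qed.

(* At the last steps, where [2n - 2 <= N <= 2n + 1], the bound by [n (n - 1) / 2]
   leaves a slack, which is preserved when [n] increases by two. *)
Lemma peel_bound_quadratic (N n : nat) : (N <= 2 * n + 1)%N ->
  (8 * peel_bound N n + N ^ 2 + N + 2 * (1 < N)
     <= 4 * (N * n) + 2 * ((N + 1) %/ 2))%N.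
Proof.
elim/nat_ind2: n => [||n IHn] leN.
- by case: N leN => [|[|N]].
- by case: N leN => [|[|[|[|N]]]].
have [leN'|ltN] := leqP N (2 * n + 1); first by have := IHn leN' => /=; lia.
have := peel_bound_bin2 N n.+2.
have [k k_lt4 defN] : exists2 k, (k < 4)%N & N = (2 * n + 2 + k)%N.
  by exists (N - (2 * n + 2))%N; lia.
move: (peel_bound N n.+2) => B; rewrite {}defN {IHn leN ltN N}.
by case: k k_lt4 => [|[|[|[|k]]]] // _; lia.
Qed.

Section PeelExtremes.

Variables (T : finType) (e : rel T) (f : T -> int) (S : {fset int}).
Hypothesis f_inj : injective f.
Hypothesis e_sums : forall u v, e u v -> f u + f v \in S.

(** With the smaller label first, an edge at the minimum is recognised by its first entry, and one
    at the maximum by its second. *)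
Definition increasing_edges (A : {set T}) : {set T * T} :=
  [set p | [&& p.1 \in A, p.2 \in A, f p.1 < f p.2 & e p.1 p.2]].

Lemma card_extremal_edges (A : {set T}) (a b : T) :
    a \in A -> b \in A -> a != b ->
    (forall v, v \in A -> f a <= f v <= f b) ->
  (#|[set p in increasing_edges A | (p.1 == a) || (p.2 == b)]|
     <= minn #|` S| (2 * (#|A| - 2)).+1)%N.
Proof.
move=> aA bA ab extr; set Q := [set p in _ | _].
rewrite leq_min; apply/andP; split.
  have uQ : uniq [seq f p.1 + f p.2 | p <- enum Q].
    rewrite map_inj_in_uniq ?enum_uniq // => -[u v] [u' v'].
    rewrite !mem_enum !inE /= => /andP[/and4P[uA vA uv _] uv_ext].
    move=> /andP[/and4P[u'A v'A uv' _] uv'_ext] eq_sum.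
    have /andP[? ?] := extr u uA; have /andP[? ?] := extr v vA.
    have /andP[? ?] := extr u' u'A; have /andP[? ?] := extr v' v'A.
    (* In the mixed case [f a + f v = f u' + f b], where [f a <= f u'] and [f v <= f b] must both be
       equalities. *)
    have [? ?] : f u = f u' /\ f v = f v'.
      by case/orP: uv_ext => /eqP ?; case/orP: uv'_ext => /eqP ?; subst; lia.
    by congr (_, _); apply: f_inj.
  have /(uniq_leq_size uQ) : {subset [seq f p.1 + f p.2 | p <- enum Q] <= S}.
    move=> s /mapP[p]; rewrite mem_enum !inE => /andP[/and4P[_ _ _ ep] _] ->.
    exact: e_sums.
  by rewrite size_map -cardE.
(* The first summand counts the possible partners of [a], the second those of [b] other than [a], so
   that the pair [(a, b)] is counted once. *)
have -> : (2 * (#|A| - 2)).+1 = (#|A :\ a| + #|A :\ a :\ b|)%N.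
  have := cardsD1 a A; have := cardsD1 b (A :\ a).
  by rewrite !inE aA bA eq_sym ab /=; lia.
have : Q \subset setX [set a] (A :\ a) :|: setX (A :\ a :\ b) [set b].
  apply/subsetP=> -[u v]; rewrite !inE /= => /andP[/and4P[uA vA uv _]].
  have [eq_ua|ua] /= := eqVneq u a => [_|/eqP eq_vb].
    by rewrite vA (contraTneq _ uv) // => ->; rewrite eq_ua ltxx.
  by rewrite uA eq_vb eqxx (contraTneq _ uv) // => ->; rewrite eq_vb ltxx.
move=> /subset_leq_card /leq_trans; apply.
by rewrite (leq_trans (leq_card_setU _ _)) // !cardsX !cards1 mul1n muln1.
Qed.

Lemma card_increasing_edges (A : {set T}) :
  (#|increasing_edges A| <= peel_bound #|` S| #|A|)%N.
Proof.
move: {2}#|A| (erefl #|A|) => n; elim/nat_ind2: n A => [||n IHn] A cardA.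
- rewrite cardA leqn0 cards_eq0; apply/eqP/setP => -[u v].
  by rewrite !inE (cards0_eq cardA) inE.
- have /eqP/cards1P[x ->] := cardA.
  rewrite cards1 leqn0 cards_eq0; apply/eqP/setP => -[u v]; rewrite !inE /=.
  by apply/negP => /and4P[/eqP-> /eqP->]; rewrite ltxx.
have /card_gt0P[x0 x0A] : (0 < #|A|)%N by rewrite cardA.
pose a := [arg min_(x < x0 in A) f x]%O; pose b := [arg max_(x > x0 in A) f x]%O.
have [aA a_min] : a \in A /\ forall v, v \in A -> f a <= f v.
  by rewrite /a; case: arg_minP.
have [bA b_max] : b \in A /\ forall v, v \in A -> f v <= f b.
  by rewrite /b; case: arg_maxP.
have extr v : v \in A -> f a <= f v <= f b by move=> vA; rewrite a_min ?b_max.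
have ab : a != b.
  apply/eqP => eq_ab.
  have : A \subset [set a].
    apply/subsetP => v vA; rewrite inE; apply/eqP/f_inj/le_anti.
    by rewrite a_min // eq_ab b_max.
  by move=> /subset_leq_card; rewrite cards1 cardA.
have cardA' : #|A :\ a :\ b| = n.
  have := cardsD1 a A; have := cardsD1 b (A :\ a).
  by rewrite !inE aA bA eq_sym ab /=; lia.
have : increasing_edges A \subset increasing_edges (A :\ a :\ b)
    :|: [set p in increasing_edges A | (p.1 == a) || (p.2 == b)].
  apply/subsetP=> -[u v]; rewrite !inE /= => /and4P[uA vA uv ->].
  rewrite uA vA uv !andbT /=.
  (* No increasing pair starts at the maximum or ends at the minimum, so a pair outside the extremal
     set avoids both vertices. *)
  have -> : u != b by apply: contraTneq uv => ->; rewrite -leNgt b_max.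
  have -> : v != a by apply: contraTneq uv => ->; rewrite -leNgt a_min.
  by case: eqP; case: eqP.
move=> /subset_leq_card /leq_trans; apply.
rewrite (leq_trans (leq_card_setU _ _)) // cardA /= -{1}cardA' leq_add ?IHn //.
by have := card_extremal_edges _ _ _ aA bA ab extr; rewrite cardA subn2.
Qed.

End PeelExtremes.

Lemma card_edge_set_le (G : sgraph) (f : G -> int) : injective f ->
  (#|edge_set G| <= peel_bound #|` edge_sums f| #|G|)%N.
Proof.
move=> f_inj; rewrite -cardsT.
have e_sums (u v : G) : sadj u v -> f u + f v \in edge_sums f.
  by move=> uv; apply/imfsetP; exists (u, v); rewrite ?inE.
apply: leq_trans (card_increasing_edges _ _ _ _ f_inj e_sums [set: G]).
(* Adjacent vertices have different labels, so every edge is the image of an increasing pair. *)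
apply: leq_trans (leq_imset_card (fun p => [set p.1; p.2]) _).
apply/subset_leq_card/subsetP => _ /imsetP[[u v] /[!inE] /= uv ->].
have : f u != f v.
  by rewrite (inj_eq f_inj); apply: contraTneq uv => ->; rewrite sadj_irr.
rewrite neq_lt => /orP[lt_uv|lt_vu].
  by apply/imsetP; exists (u, v); rewrite ?inE //= lt_uv.
by apply/imsetP; exists (v, u); rewrite ?inE /= ?lt_vu 1?sadj_sym // setUC.
Qed.

Theorem theorem3p4 (G : sgraph) (n N : nat)
    (hn : #|G| = n) (n_gt0 : (0 < n)%N) (hN : sum_index G = N) :
  ((N <= n - 1)%N ->
     (#|edge_set G|%:Z <=
       Num.floor (N%:R * n%:R / 2 - N%:R ^+ 2 / 8 - N%:R / 8
                  + ((N + 1) %/ 2)%N%:R / 4 : rat))) /\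
  ((n <= N)%N ->
     (#|edge_set G|%:Z <=
       Num.floor (N%:R * n%:R / 4 + n%:R ^+ 2 / 8 - N%:R / 4 + n%:R / 8
                  + ((N + 1) %/ 2)%N%:R / 4 - 1 / 4 : rat))).
Proof.
have [[f f_inj cardf] _] := (sum_indexP G N).1 hN.
have := card_edge_set_le _ _ f_inj; rewrite cardf hn.
move: #|edge_set G| => E leE; move: ((N + 1) %/ 2)%N (peel_bound_quadratic N n).
move=> h quad; split=> leN; rewrite floor_ge_int.
  (* Multiplying by 8 clears the denominators. *)
  have : (8 * E + N ^ 2 + N <= 4 * (N * n) + 2 * h)%N.
    by have := quad ltac:(lia); lia.
  rewrite -(ler_nat rat) !(natrD, natrM, natrX) -[E%:Z%:~R]/(E%:R); lra.
have : (8 * E + 2 * N + 2 <= 2 * (N * n) + n ^ 2 + n + 2 * h)%N.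
  have bin2 : (2 * E <= n * (n - 1))%N.
    by apply: leq_trans (peel_bound_bin2 N n); rewrite leq_mul2l.
  (* For larger [N] the bound [bin2] already suffices. *)
  have [leN2|ltN2] := leqP N (2 * n + 1); last first.
    have : ((n - 1) * (2 * n + 2) <= (n - 1) * N)%N by rewrite leq_mul2l; lia.
    by case: n n_gt0 bin2 {hn leE quad leN ltN2} => // n _; lia.
  (* The constant [- 1 / 4], scaled by 8, is paid for by the term [2 * (1 < N)] of [quad]. *)
  have [N_gt1|N_le1] := ltnP 1 N; last first.
    have [-> ->] : n = 1%N /\ N = 1%N by lia.
    by lia.
  have := quad leN2; rewrite N_gt1 => {}quad.
  (* The goal exceeds [quad] by exactly the slack in [d <= d * d] with [d = N - n]. *)
  have [d defN] : exists d, N = (n + d)%N by exists (N - n)%N; lia.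
  have : (d <= d * d)%N by case: (d) => // d'; rewrite leq_pmulr.
  by rewrite {}defN in leE quad *; lia.
rewrite -(ler_nat rat) !(natrD, natrM, natrX) -[E%:Z%:~R]/(E%:R); lra.
Qed.
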